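(* Let $(E,\mathcal{P})$ be an $L^0$-pre-barreled random locally convex module over $\mathbb{R}$ with base $(\Omega,\mathcal{F},P)$ such that $E$ has the countable concatenation property. Then every proper $\mathcal{T}_c$-lower semicontinuous $L^0$-convex function $f:E\to\bar L^0(\mathcal{F})$ is continuous on $\mathrm{Int}(\mathrm{dom}(f))$, the $\mathcal{T}_c$-interior of $\mathrm{dom}(f)$; namely $f$ is continuous from $(\mathrm{Int}(\mathrm{dom}(f)),\mathcal{T}_c)$ to $(L^0(\mathcal{F}),\mathcal{T}_c)$.
   Context: Notation. $(\Omega,\mathcal{F},P)$ is a probability space; $L^0(\mathcal{F})$ is the algebra of a.s.-equivalence classes of real-valued $\mathcal{F}$-measurable random variables; $\bar L^0(\mathcal{F})$ the set of classes of extended real-valued ones, ordered a.s., $\bigvee$ denotes supremum; $L^0_+(\mathcal{F})=\{\xi\in L^0(\mathcal{F}):\xi\ge0\}$, $L^0_{++}(\mathcal{F})=\{\xi\in L^0(\mathcal{F}):\xi>0\text{ a.s.}\}$; $\tilde I_A$ is the class of the indicator of $A\in\mathcal{F}$. ''On $\Omega$'' means a.s. An $L^0$-seminorm on an $L^0(\mathcal{F})$-module $E$ is a map $\|\cdot\|:E\to L^0_+(\mathcal{F})$ with $\|\xi x\|=|\xi|\|x\|$ for $\xi\in L^0(\mathcal{F})$ and $\|x+y\|\le\|x\|+\|y\|$. A random locally convex module $(E,\mathcal{P})$ over $\mathbb{R}$ with base $(\Omega,\mathcal{F},P)$ is an $L^0(\mathcal{F})$-module $E$ with a family $\mathcal{P}$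 of $L^0$-seminorms such that $\bigvee\{\|x\|:\|\cdot\|\in\mathcal{P}\}=0$ iff $x=\theta$ (the null element). $\mathcal{T}_c$ is the translation-invariant topology with local base at $\theta$ given by $\{x:\bigvee_{\|\cdot\|\in\mathcal{Q}}\|x\|\le\varepsilon\}$, $\mathcal{Q}\subset\mathcal{P}$ finite, $\varepsilon\in L^0_{++}(\mathcal{F})$; $L^0(\mathcal{F})$ carries $\mathcal{T}_c$ induced by $|\cdot|$. A subset $G$ of $E$ (possibly $G=E$) has the countable concatenation property if for every sequence $\{x_n\}$ in $G$ and every countable partition $\{A_n\}$ of $\Omega$ into members of $\mathcal{F}$ there is $x\in G$ with $\tilde I_{A_n}x=\tilde I_{A_n}x_n$ for all $n$. An $L^0$-barrel is a $\mathcal{T}_c$-closed set $B\subset E$ that is $L^0$-balanced ($\eta B\subset B$ for $\eta\in L^0(\mathcal{F})$, $|\eta|\le1$), $L^0$-convex ($\xi x+(1-\xi)y\in B$ for $x,y\in B$, $\xi\in L^0_+(\mathcal{F})$, $0\le\xi\le1$) and $L^0$-absorbent (for each $x\in E$ there is $\xi\in L^0_{++}(\mathcal{F})$ with $\eta x\in B$ for all $\eta\in L^0(\mathcal{F})$, $|\eta|\le\xi$). $(E,\mathcal{P})$ is $L^0$-pre-barreled if every $L^0$-barrel with the countable concatenation property is a $\mathcal{T}_c$-neighborhood of $\theta$. For $f:E\to\bar L^0(\mathcal{F})$, $\mathrm{dom}(f)=\{x\in E:f(x)<+\infty\text{ on }\Omega\}$. $f$ is proper if $\mathrm{dom}(f)\ne\emptyset$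 and $f(x)>-\infty$ on $\Omega$ for all $x\in E$. $f$ is $L^0$-convex if $f(\xi x+(1-\xi)y)\le\xi f(x)+(1-\xi)f(y)$ for all $x,y\in E$ and $\xi\in L^0_+(\mathcal{F})$, $0\le\xi\le1$, with $0\cdot(\pm\infty)=0$ and $+\infty\pm(\pm\infty)=+\infty$. $f$ is $\mathcal{T}_c$-lower semicontinuous if $\{x\in E:f(x)\le r\}$ is $\mathcal{T}_c$-closed for every $r\in L^0(\mathcal{F})$. *)

(* Defs.v *)
From HB Require Import structures.
From mathcomp Require Import all_boot all_order all_algebra.
From mathcomp Require Import all_classical all_reals all_analysis.
From mathcomp Require Import measurable_realfun.
Set Implicit Arguments.
Unset Strict Implicit.
Unset Printing Implicit Defensive.
Import Order.TTheory GRing.Theory Num.Theory.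
Local Open Scope classical_set_scope.
Local Open Scope ring_scope.
Local Open Scope quotient_scope.

Section L0.
Context d (T : measurableType d) (R : realType) (P : probability T R).

Definition L0 : Type := {mfun_ P, T >-> R}.
Definition barL0 : Type := {mfun_ P, T >-> \bar R}.

HB.instance Definition _ := Choice.on L0.
HB.instance Definition _ := EqQuotient.on L0.
HB.instance Definition _ := Choice.on barL0.
HB.instance Definition _ := EqQuotient.on barL0.

(* The value at a point of a chosen representative: meaningful only under an
   almost-everywhere quantifier. *)
Definition L0_fun (xi : L0) : T -> R := repr xi.
Definition barL0_fun (xi : barL0) : T -> \bar R := repr xi.
Coercion L0_fun : L0 >-> Funclass.
Coercion barL0_fun : barL0 >-> Funclass.

Definition L0_class (f : T -> R) (mf : measurable_fun setT f) : L0 :=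
  \pi_(L0) (mfun_Sub (mem_set mf)).
Definition barL0_class (f : T -> \bar R) (mf : measurable_fun setT f) : barL0 :=
  \pi_(barL0) (mfun_Sub (mem_set mf)).

Lemma L0_measurable (xi : L0) : measurable_fun setT xi.
Proof. exact: (@measurable_funPT _ _ _ _ (repr xi)). Qed.

Lemma barL0_measurable (xi : barL0) : measurable_fun setT xi.
Proof. exact: (@measurable_funPT _ _ _ _ (repr xi)). Qed.

Lemma L0_classE f (mf : measurable_fun setT f) :
  \forall w \ae P, L0_class mf w = f w.
Proof.
have : L0_class mf = \pi_(L0) (mfun_Sub (mem_set mf)) by [].
rewrite -{1}[L0_class mf]reprK => /eqquotP/asboolP.
by apply: filterS => w /(_ I).
Qed.

Lemma barL0_classE f (mf : measurable_fun setT f) :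
  \forall w \ae P, barL0_class mf w = f w.
Proof.
have : barL0_class mf = \pi_(barL0) (mfun_Sub (mem_set mf)) by [].
rewrite -{1}[barL0_class mf]reprK => /eqquotP/asboolP.
by apply: filterS => w /(_ I).
Qed.

Lemma L0P (xi eta : L0) : (\forall w \ae P, xi w = eta w) <-> xi = eta.
Proof.
split=> [h|->]; last exact: aeW.
rewrite -[xi]reprK -[eta]reprK; apply/eqquotP/asboolP.
by apply: filterS h => w h _.
Qed.

Lemma barL0P (xi eta : barL0) : (\forall w \ae P, xi w = eta w) <-> xi = eta.
Proof.
split=> [h|->]; last exact: aeW.
rewrite -[xi]reprK -[eta]reprK; apply/eqquotP/asboolP.
by apply: filterS h => w h _.
Qed.

Definition L0_cst (r : R) : L0 := L0_class (@measurable_cst _ _ T R setT r).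

Definition L0_add (xi eta : L0) : L0 :=
  L0_class (measurable_funD (L0_measurable xi) (L0_measurable eta)).

Definition L0_opp (xi : L0) : L0 :=
  L0_class (measurableT_comp (@oppr_measurable R setT) (L0_measurable xi)).

Definition L0_mul (xi eta : L0) : L0 :=
  L0_class (measurable_funM (L0_measurable xi) (L0_measurable eta)).

Definition L0_abs (xi : L0) : L0 :=
  L0_class (measurableT_comp (@normr_measurable R setT) (L0_measurable xi)).

Definition L0_min (xi eta : L0) : L0 :=
  L0_class (measurable_minr (L0_measurable xi) (L0_measurable eta)).

Definition L0_indic (A : set T) (mA : measurable A) : L0 :=
  L0_class (@measurable_indic _ T R setT A mA).

Definition L0_ext (xi : L0) : barL0 :=
  barL0_class (measurableT_comp (@EFin_measurable R setT) (L0_measurable xi)).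

Definition barL0_cst (x : \bar R) : barL0 :=
  barL0_class (@measurable_cst _ _ T (\bar R) setT x).

Definition barL0_max (xi eta : barL0) : barL0 :=
  barL0_class (measurable_maxe (barL0_measurable xi) (barL0_measurable eta)).

Let addE xi eta : \forall w \ae P, L0_add xi eta w = xi w + eta w.
Proof. exact: L0_classE. Qed.
Let oppE xi : \forall w \ae P, L0_opp xi w = - xi w.
Proof. exact: L0_classE. Qed.
Let mulE xi eta : \forall w \ae P, L0_mul xi eta w = xi w * eta w.
Proof. exact: L0_classE. Qed.
Lemma L0_cstE r : \forall w \ae P, L0_cst r w = r.
Proof. exact: L0_classE. Qed.
Lemma L0_absE xi : \forall w \ae P, L0_abs xi w = `|xi w|.
Proof. exact: L0_classE. Qed.
Lemma L0_minE xi eta : \forall w \ae P, L0_min xi eta w = Num.min (xi w) (eta w).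
Proof. exact: L0_classE. Qed.
Lemma L0_indicE A (mA : measurable A) : \forall w \ae P, L0_indic mA w = \1_A w.
Proof. exact: L0_classE. Qed.
Lemma L0_extE xi : \forall w \ae P, L0_ext xi w = (xi w)%:E.
Proof. exact: barL0_classE. Qed.
Lemma barL0_cstE x : \forall w \ae P, barL0_cst x w = x.
Proof. exact: barL0_classE. Qed.
Lemma barL0_maxE xi eta : \forall w \ae P, barL0_max xi eta w = maxe (xi w) (eta w).
Proof. exact: barL0_classE. Qed.

Let addA : associative L0_add.
Proof.
move=> x y z; apply/L0P; near=> w; rewrite (near (addE x _)) //.
rewrite (near (addE y z)) // (near (addE _ z)) // (near (addE x y)) //.
by rewrite addrA.
Unshelve. all: by end_near. Qed.

Let addC : commutative L0_add.
Proof.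
move=> x y; apply/L0P; near=> w; rewrite (near (addE x y)) //.
by rewrite (near (addE y x)) // addrC.
Unshelve. all: by end_near. Qed.

Let add0 : left_id (L0_cst 0) L0_add.
Proof.
move=> x; apply/L0P; near=> w; rewrite (near (addE _ x)) //.
by rewrite (near (L0_cstE 0)) // add0r.
Unshelve. all: by end_near. Qed.

Let addN : left_inverse (L0_cst 0) L0_opp L0_add.
Proof.
move=> x; apply/L0P; near=> w; rewrite (near (addE _ x)) //.
by rewrite (near (oppE x)) // (near (L0_cstE 0)) // addNr.
Unshelve. all: by end_near. Qed.

HB.instance Definition _ := GRing.isZmodule.Build L0 addA addC add0 addN.

Let mulA : associative L0_mul.
Proof.
move=> x y z; apply/L0P; near=> w; rewrite (near (mulE x _)) //.
rewrite (near (mulE y z)) // (near (mulE _ z)) // (near (mulE x y)) //.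
by rewrite mulrA.
Unshelve. all: by end_near. Qed.

Let mulC : commutative L0_mul.
Proof.
move=> x y; apply/L0P; near=> w; rewrite (near (mulE x y)) //.
by rewrite (near (mulE y x)) // mulrC.
Unshelve. all: by end_near. Qed.

Let mul1 : left_id (L0_cst 1) L0_mul.
Proof.
move=> x; apply/L0P; near=> w; rewrite (near (mulE _ x)) //.
by rewrite (near (L0_cstE 1)) // mul1r.
Unshelve. all: by end_near. Qed.

Let mulD : left_distributive L0_mul +%R.
Proof.
move=> x y z; apply/L0P; near=> w; rewrite (near (mulE _ z)) //.
rewrite (near (addE x y)) // (near (addE (L0_mul x z) _)) //.
by rewrite (near (mulE x z)) // (near (mulE y z)) // mulrDl.
Unshelve. all: by end_near. Qed.

Let oner_neq0 : L0_cst 1 != 0.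
Proof.
apply/eqP => /L0P h; have : \forall w \ae P, (1 : R) = 0.
  near=> w; rewrite -(near (L0_cstE 1) w) // (near h w) //.
  by rewrite (near (L0_cstE 0) w).
have PP : ProperFilter (almost_everywhere P).
  apply: ae_properfilter_algebraOfSetsType.
  rewrite (_ : _ [set: T] = 1%E) ?lte01//; exact: probability_setT.
by move=> /filter_ex[_ /eqP]; rewrite oner_eq0.
Unshelve. all: by end_near. Qed.

HB.instance Definition _ :=
  GRing.Zmodule_isComNzRing.Build L0 mulA mulC mul1 mulD oner_neq0.

Lemma L0_addE (xi eta : L0) : \forall w \ae P, (xi + eta : L0) w = xi w + eta w.
Proof. exact: addE. Qed.
Lemma L0_oppE (xi : L0) : \forall w \ae P, (- xi : L0) w = - xi w.
Proof. exact: oppE. Qed.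
Lemma L0_mulE (xi eta : L0) : \forall w \ae P, (xi * eta : L0) w = xi w * eta w.
Proof. exact: mulE. Qed.
Lemma L0_0E : \forall w \ae P, (0 : L0) w = 0.
Proof. exact: L0_cstE. Qed.
Lemma L0_1E : \forall w \ae P, (1 : L0) w = 1.
Proof. exact: L0_cstE. Qed.

Definition L0_le (xi eta : L0) := `[< \forall w \ae P, xi w <= eta w >].
Definition barL0_le (xi eta : barL0) := `[< \forall w \ae P, (xi w <= eta w)%E >].

Let L0_le_refl : reflexive L0_le.
Proof. by move=> x; apply/asboolP/aeW => w. Qed.
Let L0_le_anti : antisymmetric L0_le.
Proof.
move=> x y /andP[/asboolP h1 /asboolP h2]; apply/L0P.
by apply: filterS2 h1 h2 => w h1 h2; apply/eqP; rewrite eq_le h1.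
Qed.
Let L0_le_trans : transitive L0_le.
Proof.
move=> y x z /asboolP h1 /asboolP h2; apply/asboolP.
by apply: filterS2 h1 h2 => w; exact: le_trans.
Qed.

HB.instance Definition _ :=
  Order.Le_isPOrder.Build ring_display L0 L0_le_refl L0_le_anti L0_le_trans.

Let barL0_le_refl : reflexive barL0_le.
Proof. by move=> x; apply/asboolP/aeW => w. Qed.
Let barL0_le_anti : antisymmetric barL0_le.
Proof.
move=> x y /andP[/asboolP h1 /asboolP h2]; apply/barL0P.
by apply: filterS2 h1 h2 => w h1 h2; apply/eqP; rewrite eq_le h1.
Qed.
Let barL0_le_trans : transitive barL0_le.
Proof.
move=> y x z /asboolP h1 /asboolP h2; apply/asboolP.
by apply: filterS2 h1 h2 => w; exact: le_trans.
Qed.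

HB.instance Definition _ :=
  Order.Le_isPOrder.Build ereal_display barL0
    barL0_le_refl barL0_le_anti barL0_le_trans.

Lemma L0_leP (xi eta : L0) : (\forall w \ae P, xi w <= eta w) <-> xi <= eta.
Proof. by split=> /asboolP. Qed.

Lemma barL0_leP (xi eta : barL0) :
  (\forall w \ae P, (xi w <= eta w)%E) <-> (xi <= eta)%O.
Proof. by split=> /asboolP. Qed.

(* For nonempty A the default value of supremum is irrelevant, as barL0 is a
   complete lattice; for A = set0 this gives -oo, the least element. *)
Definition bigvee (A : set barL0) : barL0 := supremum (barL0_cst -oo) A.

(* This is "xi > 0 almost surely", which is stronger than 0 < xi in the order
   of L0. *)
Definition L0pp (xi : L0) : Prop := \forall w \ae P, 0 < xi w.

Lemma finite_supremums (A : set barL0) : finite_set A -> A !=set0 ->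
  supremums A !=set0.
Proof.
move=> /finite_setP[n]; elim: n A => [|n IHn] A.
  by rewrite II0 card_eq0 => /eqP -> [].
move=> /eq_cardSP[x Ax cA] _.
have [A0|/set0P A0] := eqVneq (A `\ x) set0.
  exists x; split=> [y Ay|y]; last exact.
  have [->|/eqP yx] := eqVneq y x; first exact: lexx.
  by have : (A `\ x) y by []; rewrite A0.
have [s [us ls]] := IHn _ cA A0.
exists (barL0_max x s); split=> [y Ay|u uA].
  apply/barL0_leP; have [->|/eqP yx] := eqVneq y x.
    by apply: filterS (barL0_maxE x s) => w ->; rewrite le_max lexx.
  have /barL0_leP ys : (y <= s)%O by apply: us.
  by apply: filterS2 (barL0_maxE x s) ys => w -> ys; rewrite le_max ys orbT.
apply/barL0_leP; have /barL0_leP xu : (x <= u)%O by exact: uA.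
have /barL0_leP su : (s <= u)%O by apply: ls => y [Ay _]; apply: uA.
by apply: filterS3 (barL0_maxE x s) xu su => w ->; rewrite ge_max => -> ->.
Qed.

Lemma bigvee_finite_le (A : set barL0) (xi : barL0) : finite_set A ->
  (bigvee A <= xi)%O <-> ubound A xi.
Proof.
move=> fA; rewrite /bigvee /supremum; case: ifPn => [/eqP ->|/set0P A0].
  split=> [_ y []|_]; apply/barL0_leP.
  by apply: filterS (barL0_cstE -oo%E) => w ->; rewrite leNye.
case: xgetP => [s _ [us ls]|]; last first.
  by have [s ss] := finite_supremums fA A0 => /(_ s).
by split=> [sx y Ay|/ls//]; rewrite (le_trans _ sx)// us.
Qed.

End L0.

Arguments L0 {d T R} P.
Arguments barL0 {d T R} P.
Arguments barL0_cst {d T R} P x.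
Arguments L0_cst {d T R} P r.
Arguments L0_cstE {d T R} P r.
Arguments barL0_cstE {d T R} P x.
Arguments L0_0E {d T R} P.
Arguments L0_1E {d T R} P.
Arguments L0_indic {d T R} P {A} mA.

Section L0_seminorm.
Context d (T : measurableType d) (R : realType) (P : probability T R).

Definition L0_seminorm (E : lmodType (L0 P)) (p : E -> L0 P) : Prop :=
  [/\ forall x, 0 <= p x,
      forall (xi : L0 P) x, p (xi *: x) = L0_abs xi * p x &
      forall x y, p (x + y) <= p x + p y].

(* The supremum over the family S of the values at x. *)
Definition bigvee_seminorm (E : lmodType (L0 P)) (S : set (E -> L0 P)) (x : E) :
    barL0 P :=
  bigvee [set L0_ext (p x) | p in S].

End L0_seminorm.

HB.mixin Record isRandomLocallyConvex d (T : measurableType d) (R : realType)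
    (P : probability T R) E & GRing.Lmodule (L0 P) E := {
  L0_seminorms : set (E -> L0 P) ;
  L0_seminormsP : forall p, L0_seminorms p -> L0_seminorm p ;
  L0_seminorms_separated : forall x : E,
    bigvee_seminorm L0_seminorms x = barL0_cst P 0%E <-> x = 0
}.

#[short(type="rlcModType")]
HB.structure Definition RandomLocallyConvex d (T : measurableType d)
    (R : realType) (P : probability T R) :=
  {E of GRing.Lmodule (L0 P) E & isRandomLocallyConvex d T R P E}.

(* (E, T_c): a copy of E carrying the topology T_c. *)
Definition Tc d (T : measurableType d) (R : realType) (P : probability T R)
  (E : rlcModType P) : Type := E.

Section Tc_topology.
Context d (T : measurableType d) (R : realType) (P : probability T R).
Variable E : rlcModType P.

HB.instance Definition _ := GRing.Lmodule.on (Tc E).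

Definition Tc_ball (Q : set (E -> L0 P)) (eps : L0 P) : set E :=
  [set x | (bigvee_seminorm Q x <= L0_ext eps)%O].

Definition Tc_nbhs (x : Tc E) (A : set (Tc E)) : Prop :=
  exists Q eps, [/\ finite_set Q, Q `<=` L0_seminorms, L0pp eps &
    forall y : E, Tc_ball Q eps y -> A (x + y)].

Lemma L0_ext_le (xi eta : L0 P) : (L0_ext xi <= L0_ext eta)%O <-> xi <= eta.
Proof.
split=> [/barL0_leP h|/L0_leP h]; [apply/L0_leP|apply/barL0_leP].
  by apply: filterS3 (L0_extE xi) (L0_extE eta) h => w -> ->; rewrite lee_fin.
by apply: filterS3 (L0_extE xi) (L0_extE eta) h => w -> ->; rewrite lee_fin.
Qed.

Lemma Tc_ballP Q eps y : finite_set Q ->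
  Tc_ball Q eps y <-> forall p, Q p -> p y <= eps.
Proof.
move=> fQ; rewrite /Tc_ball /=.
apply: (iff_trans (bigvee_finite_le _ (finite_image _ fQ))).
split=> [h p Qp|h _ [p Qp <-]]; first by apply/L0_ext_le/h; exists p.
exact/L0_ext_le/h.
Qed.

Let seminorm0 p : L0_seminorms p -> p (0 : E) = 0.
Proof.
move=> /L0_seminormsP[_ pZ _]; rewrite -(scale0r 0) pZ; apply/L0P.
near=> w; rewrite (near (L0_mulE _ _) w)// (near (L0_absE _) w)//.
by rewrite (near (L0_0E P) w)// normr0 mul0r.
Unshelve. all: by end_near. Qed.

Let Tc_ball0 Q eps : finite_set Q -> Q `<=` L0_seminorms -> L0pp eps ->
  Tc_ball Q eps 0.
Proof.
move=> fQ sQ e0; apply/(Tc_ballP _ _ fQ) => p /sQ /seminorm0 ->.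
apply/L0_leP; near=> w; rewrite (near (L0_0E P) w)//.
by apply: ltW; apply: (near e0 w).
Unshelve. all: by end_near. Qed.

Let Tc_nbhs_singleton x A : Tc_nbhs x A -> A x.
Proof.
by move=> [Q [eps [fQ sQ e0]]] /(_ _ (Tc_ball0 fQ sQ e0)); rewrite addr0.
Qed.

Let Tc_nbhs_filter x : ProperFilter (Tc_nbhs x).
Proof.
apply: Build_ProperFilter_ex => [A /Tc_nbhs_singleton Ax|]; first by exists x.
split=> [|A B|A B AB].
- exists set0, 1; split=> //.
  by apply: filterS (L0_1E P) => w ->; exact: ltr01.
- move=> [Q1 [e1 [fQ1 sQ1 e10 h1]]] [Q2 [e2 [fQ2 sQ2 e20 h2]]].
  exists (Q1 `|` Q2), (L0_min e1 e2); split=> [||| y].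
  + by rewrite finite_setU.
  + by move=> p [/sQ1|/sQ2].
  + by apply: filterS3 (L0_minE e1 e2) e10 e20 => w ->; rewrite lt_min => -> ->.
  + move=> /Tc_ballP; rewrite finite_setU => /(_ (conj fQ1 fQ2)) h; split.
    * apply/h1/(Tc_ballP _ _ fQ1) => p Qp.
      apply: (le_trans (h p (or_introl Qp))); apply/L0_leP.
      by apply: filterS (L0_minE e1 e2) => w ->; rewrite ge_min lexx.
    * apply/h2/(Tc_ballP _ _ fQ2) => p Qp.
      apply: (le_trans (h p (or_intror Qp))); apply/L0_leP.
      by apply: filterS (L0_minE e1 e2) => w ->; rewrite ge_min lexx orbT.
- move=> [Q [eps [fQ sQ e0 h]]]; exists Q, eps; split=> // y /h; exact: AB.
Qed.

Let Tc_nbhs_nbhs x A : Tc_nbhs x A -> Tc_nbhs x (Tc_nbhs^~ A).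
Proof.
move=> [Q [eps [fQ sQ e0 h]]].
pose e2 := L0_cst P 2^-1 * eps.
have e2E : \forall w \ae P, (e2 : L0 P) w = eps w / 2.
  near=> w; rewrite (near (L0_mulE _ _) w)// (near (L0_cstE P _) w)//.
  by rewrite mulrC.
have e20 : L0pp e2.
  by apply: filterS2 e2E e0 => w -> ?; rewrite divr_gt0.
exists Q, e2; split=> // y /(Tc_ballP _ _ fQ) hy.
exists Q, e2; split=> // z /(Tc_ballP _ _ fQ) hz.
rewrite -addrA; apply/h/(Tc_ballP _ _ fQ) => p Qp.
have [_ _ pD] := L0_seminormsP p (sQ _ Qp).
apply: (le_trans (pD _ _)).
have /L0_leP py := hy _ Qp; have /L0_leP pz := hz _ Qp.
apply/L0_leP; near=> w; rewrite (near (L0_addE _ _) w)//.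
rewrite [leRHS]splitr; apply: lerD.
  by rewrite -(near e2E w)//; apply: (near py w).
by rewrite -(near e2E w)//; apply: (near pz w).
Unshelve. all: by end_near. Qed.

HB.instance Definition _ := hasNbhs.Build (Tc E) Tc_nbhs.
HB.instance Definition _ := Nbhs_isNbhsTopological.Build (Tc E)
  Tc_nbhs_filter Tc_nbhs_singleton Tc_nbhs_nbhs.

End Tc_topology.

Section L0_regular.
Context d (T : measurableType d) (R : realType) (P : probability T R).

Let abs_seminorms : set ((L0 P)^o -> L0 P) := [set @L0_abs d T R P].

Let abs_seminormsP p : abs_seminorms p -> L0_seminorm p.
Proof.
move=> ->; split=> [x|xi x|x y].
- apply/L0_leP; apply: filterS2 (L0_absE x) (L0_0E P) => w -> ->.
  exact: normr_ge0.
- apply/L0P; near=> w; rewrite (near (L0_absE _) w)//.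
  rewrite (near (L0_mulE _ _) w)// (near (L0_mulE xi x) w)//.
  by rewrite !(near (L0_absE _) w)// normrM.
- apply/L0_leP; near=> w; rewrite (near (L0_absE _) w)//.
  rewrite (near (L0_addE _ _) w)// (near (L0_addE x y) w)//.
  by rewrite !(near (L0_absE _) w)// ler_normD.
Unshelve. all: by end_near. Qed.

Let abs_seminorms_separated (x : (L0 P)^o) :
  bigvee_seminorm abs_seminorms x = barL0_cst P 0%E <-> x = 0.
Proof.
rewrite /bigvee_seminorm image_set1 /bigvee supremum1; split.
  move=> /barL0P h; apply/L0P; near=> w.
  rewrite (near (L0_0E P) w)//; apply/eqP.
  rewrite -normr_eq0 -(near (L0_absE x) w)//; apply/eqP/EFin_inj.
  by rewrite -(near (L0_extE _) w)// (near h w)// (near (barL0_cstE P _) w).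
move=> ->; apply/barL0P; near=> w; rewrite (near (L0_extE _) w)//.
rewrite (near (L0_absE _) w)// (near (L0_0E P) w)// normr0.
by rewrite (near (barL0_cstE P _) w).
Unshelve. all: by end_near. Qed.

HB.instance Definition _ := isRandomLocallyConvex.Build d T R P (L0 P)^o
  abs_seminormsP abs_seminorms_separated.

End L0_regular.

Section notions.
Context d (T : measurableType d) (R : realType) (P : probability T R).
Variable E : rlcModType P.
Implicit Types (B G : set E) (f : E -> barL0 P).

(* Members of the partition may be empty, which covers finite partitions. *)
Definition countable_concatenation G : Prop :=
  forall (x : nat -> E) (A : nat -> set T) (mA : forall n, measurable (A n)),
    (forall n, G (x n)) -> trivIset setT A -> \bigcup_n A n = setT ->
    exists2 y, G y & forall n, L0_indic P (mA n) *: y = L0_indic P (mA n) *: x n.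

Definition L0_balanced B : Prop :=
  forall (eta : L0 P) x, L0_abs eta <= 1 -> B x -> B (eta *: x).

Definition L0_convex_set B : Prop :=
  forall (xi : L0 P) x y, 0 <= xi <= 1 -> B x -> B y ->
    B (xi *: x + (1 - xi) *: y).

Definition L0_absorbent B : Prop :=
  forall x, exists2 xi : L0 P, L0pp xi &
    forall eta : L0 P, L0_abs eta <= xi -> B (eta *: x).

Definition L0_barrel B : Prop :=
  [/\ closed (B : set (Tc E)), L0_balanced B, L0_convex_set B &
      L0_absorbent B].

Definition L0_pre_barreled : Prop :=
  forall B, L0_barrel B -> countable_concatenation B -> nbhs (0 : Tc E) B.

Definition L0_dom f : set (Tc E) := [set x | \forall w \ae P, (f x w < +oo)%E].

Definition L0_proper f : Prop :=
  L0_dom f !=set0 /\ forall x, \forall w \ae P, (-oo < f x w)%E.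

(* The scope %dE is that of the addition for which +oo - oo = +oo; in it
   0 * +oo = 0 * -oo = 0. *)
Definition L0_convex_fun f : Prop :=
  forall (xi : L0 P) x y, 0 <= xi <= 1 ->
    \forall w \ae P,
      (f (xi *: x + (1 - xi) *: y)%R w <=
       (xi w)%:E * f x w + (((1 - xi)%R : L0 P) w)%:E * f y w)%dE.

Definition Tc_lower_semicontinuous f : Prop :=
  forall r : L0 P, closed ([set x | (f x <= L0_ext r)%O] : set (Tc E)).

End notions.
Arguments L0_pre_barreled {d T R P} E.

(* Main.v *)
(* Fix [x0] in the interior of dom f and put
   [B = {x | f (x0 + x) <= f x0 + 1 and f (x0 - x) <= f x0 + 1}].  Convexity and
   lower semicontinuity make [B] an L0-barrel: it is absorbent because, for
   small [dl], [f] is finite at [x0 + dl x] and [x0 - dl x] and lies below the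
   chords from [x0].  Convexity with indicator weights makes [f] local, so [B]
   inherits countable concatenation from [E].  Hence [B] is a neighborhood of 0,
   i.e. [f] is bounded above near [x0], and the classical scaling and midpoint
   argument gives continuity at [x0]. *)
Require Import Defs.
From mathcomp Require Import all_boot all_order all_algebra.
From mathcomp Require Import all_classical all_reals all_analysis.
From mathcomp Require Import measurable_realfun lra ring.
Set Implicit Arguments.
Unset Strict Implicit.
Unset Printing Implicit Defensive.
Import Order.TTheory GRing.Theory Num.Theory DualAddTheory.
Local Open Scope classical_set_scope.
Local Open Scope ring_scope.

(** * Arithmetic of almost surely positive elements of [L0 P] *)

Section L0_facts.
Context d (T : measurableType d) (R : realType) (P : probability T R).
Implicit Types (xi eta eps : L0 P).

Lemma L0pp1 : L0pp (1 : L0 P).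
Proof. by apply: filterS (L0_1E P) => w ->; exact: ltr01. Qed.

Lemma L0ppM xi eta : L0pp xi -> L0pp eta -> L0pp (xi * eta).
Proof.
move=> x0 e0; apply: filterS3 (L0_mulE xi eta) x0 e0 => w ->.
exact: mulr_gt0.
Qed.

Lemma L0pp_min xi eta : L0pp xi -> L0pp eta -> L0pp (L0_min xi eta).
Proof.
move=> x0 e0; apply: filterS3 (L0_minE xi eta) x0 e0 => w -> x0 e0.
by rewrite lt_min x0.
Qed.

Lemma L0_min_le xi eta : L0_min xi eta <= xi /\ L0_min xi eta <= eta.
Proof.
split; apply/L0_leP; apply: filterS (L0_minE xi eta) => w ->.
  by rewrite ge_min lexx.
by rewrite ge_min lexx orbT.
Qed.

(** The inverse is the power with exponent -1, which is measurable and agrees with [(xi w)^-1]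
    wherever [xi w] is nonnegative. *)
Lemma L0pp_inv xi : L0pp xi -> exists2 eta, L0pp eta & eta * xi = 1.
Proof.
move=> x0.
have mf := measurableT_comp (@measurable_powR R (-1)) (L0_measurable xi).
have etaE : \forall w \ae P, L0_class P mf w = (xi w)^-1.
  by apply: filterS2 (L0_classE P mf) x0 => w -> /ltW; exact: powR_inv1.
exists (L0_class P mf).
  by apply: filterS2 etaE x0 => w ->; rewrite invr_gt0.
apply/L0P; near=> w; rewrite (near (L0_mulE _ xi) w)// (near etaE w)//.
rewrite (near (L0_1E P) w)// mulVf// gt_eqF//; exact: (near x0 w).
Unshelve. all: by end_near. Qed.

(* The witness is [1 / (1 + |M|)]. *)
Lemma L0pp_small (M : L0 P) : exists2 l : L0 P, L0pp l &
  \forall w \ae P, l w <= 1 /\ l w * `|M w| <= 1.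
Proof.
have Mpp : L0pp (1 + L0_abs M).
  near=> w; rewrite (near (L0_addE _ _) w)// (near (L0_1E P) w)//.
  by rewrite (near (L0_absE _) w)//; have := normr_ge0 (M w); lra.
have [l l0 lM] := L0pp_inv Mpp; exists l => //.
have {}lM : \forall w \ae P, l w * (1 + `|M w|) = 1.
  near=> w; rewrite -(near (L0_absE M) w)// -(near (L0_1E P) w)//.
  rewrite -(near (L0_addE 1 (L0_abs M)) w)// -(near (L0_mulE l _) w)//.
  by rewrite lM.
apply: filterS2 l0 lM => w l0; rewrite mulrDr mulr1 => lM.
have : 0 <= l w * `|M w| by rewrite mulr_ge0// ltW.
by split; lra.
Unshelve. all: by end_near. Qed.

Lemma L0_abs_1 : L0_abs (1 : L0 P) = 1.
Proof.
apply/L0P; apply: filterS2 (L0_absE (1 : L0 P)) (L0_1E P) => w -> ->.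
exact: normr1.
Qed.

Lemma L0_abs_opp (xi : L0 P) : L0_abs (- xi) = L0_abs xi.
Proof.
apply/L0P; apply: filterS3 (L0_absE (- xi)) (L0_absE xi) (L0_oppE xi).
by move=> w -> -> ->; rewrite normrN.
Qed.

End L0_facts.

(** * Seminorm balls, and convexity read almost everywhere *)

Section module_facts.
Context d (T : measurableType d) (R : realType) (P : probability T R).
Variable E : rlcModType P.
Implicit Types (Q : set (E -> L0 P)) (f : E -> barL0 P).

(** Basic neighborhoods of 0 are absorbent: if [M] bounds the finitely many values [p x] and
    [l * M <= 1], then [dl = l * eps] works. *)
Lemma finite_seminorms_absorb Q (eps : L0 P) (x : E) :
  finite_set Q -> Q `<=` L0_seminorms -> L0pp eps ->
  exists2 dl : L0 P, L0pp dl &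
    forall eta : L0 P, L0_abs eta <= dl -> forall p, Q p -> p (eta *: x) <= eps.
Proof.
move=> /finite_seqP[s ->] sQ e0.
(* Adding up the absolute values of the [p x] gives a common bound that is also nonnegative. *)
have [M hM] : exists M : L0 P, \forall w \ae P,
    0 <= M w /\ forall p, p \in s -> (p x : L0 P) w <= M w.
  elim: s {sQ} => [|p s [M IH]].
    by exists 0; apply: filterS (L0_0E P) => w ->.
  exists (L0_abs (p x) + M); near=> w.
  case: (near IH w) => // M0 sM.
  rewrite (near (L0_addE _ _) w)// (near (L0_absE _) w)//.
  have := normr_ge0 ((p x : L0 P) w); have := ler_norm ((p x : L0 P) w).
  move=> ? ?; split; first lra.
  by move=> q; rewrite inE => /orP[/eqP ->|/sM]; lra.
have [l l0 hl] := L0pp_small M.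
exists (l * eps); first exact: L0ppM.
move=> eta /L0_leP etal p ps; have [_ pZ _] := L0_seminormsP p (sQ _ ps).
have /L0_leP p0 := (let: And3 p0 _ _ := L0_seminormsP p (sQ _ ps) in p0 x).
rewrite pZ; apply/L0_leP; near=> w.
case: (near hM w) => // M0 /(_ p ps) pM.
case: (near hl w) => // _; rewrite ger0_norm// => lM.
have lw : 0 < l w by apply: (near l0 w).
have ew : 0 < eps w by apply: (near e0 w).
have pw : 0 <= (p x : L0 P) w.
  by rewrite -(near (L0_0E P) w)//; apply: (near p0 w).
have : L0_abs eta w <= (l * eps : L0 P) w by apply: (near etal w).
rewrite !(near (L0_mulE _ _) w)// (near (L0_absE _) w)// => nw.
have h1 : `|eta w| * (p x : L0 P) w <= l w * eps w * M w.
  by apply: ler_pM.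
have h2 : eps w * (l w * M w) <= eps w * 1 by rewrite ler_wpM2l// ltW.
by apply: (le_trans h1); rewrite mulrAC mulrC -[leRHS]mulr1.
Unshelve. all: by end_near. Qed.

(** A factor of modulus at most 1 does not increase any seminorm, so the same [Q] and [eps] serve at
    source and target. *)
Lemma continuous_affine (x0 : E) (eta : L0 P) : L0_abs eta <= 1 ->
  continuous (fun x : Tc E => (x0 + eta *: x : Tc E)).
Proof.
move=> eta1 x A [Q [eps [fQ sQ e0 h]]]; exists Q, eps; split=> // y.
move=> /(Tc_ballP _ _ fQ) Qy; rewrite /preimage/= scalerDr addrA; apply: h.
apply/(Tc_ballP _ _ fQ) => p Qp; have [p0 pZ _] := L0_seminormsP p (sQ _ Qp).
apply: le_trans (Qy p Qp); rewrite pZ; apply/L0_leP.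
move/L0_leP: eta1 => eta1; have /L0_leP py := p0 y.
near=> w; rewrite (near (L0_mulE _ _) w)//.
rewrite ler_piMl//.
  by rewrite -(near (L0_0E P) w)//; apply: (near py w).
by rewrite -(near (L0_1E P) w)//; apply: (near eta1 w).
Unshelve. all: by end_near. Qed.

(** Convexity in terms of finite upper bounds, so that later estimates take place in [L0 P] without
    infinities. *)
Lemma L0_convex_epigraph f (xi a b : L0 P) (x y : E) :
  L0_convex_fun f -> 0 <= xi <= 1 ->
  (f x <= L0_ext a)%O -> (f y <= L0_ext b)%O ->
  (f (xi *: x + (1 - xi) *: y) <= L0_ext (xi * a + (1 - xi) * b))%O.
Proof.
move=> cf xi01 /barL0_leP fa /barL0_leP fb; apply/barL0_leP.
have fc := cf xi x y xi01; move: xi01 => /andP[/L0_leP xi0 /L0_leP xi1].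
near=> w; apply: (le_trans (near fc w _)) => //.
rewrite (near (L0_extE _) w)// (near (L0_addE (xi * a) _) w)//.
rewrite !(near (L0_mulE _ _) w)//.
have x0 : 0 <= xi w.
  by rewrite -(near (L0_0E P) w)//; apply: (near xi0 w).
have E1 : (1 - xi : L0 P) w = 1 - xi w.
  rewrite (near (L0_addE _ _) w)// (near (L0_oppE _) w)//.
  by rewrite (near (L0_1E P) w).
have x1 : 0 <= (1 - xi : L0 P) w.
  by rewrite E1 subr_ge0 -(near (L0_1E P) w)//; apply: (near xi1 w).
rewrite dEFinD !EFinM.
apply: lee_dD; apply: lee_wpmul2l; rewrite ?lee_fin//.
  by rewrite -(near (L0_extE a) w)//; apply: (near fa w).
by rewrite -(near (L0_extE b) w)//; apply: (near fb w).
Unshelve. all: by end_near. Qed.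

(** With the indicator of [A n] as weight, convexity gives [f y <= f (x n)] on [A n]: the other
    coefficient vanishes there, and [0 * f y = 0] even when [f y] is infinite. *)
Lemma L0_convex_local f (x : nat -> E) (y : E) (A : nat -> set T)
    (mA : forall n, measurable (A n)) (r : L0 P) :
  L0_convex_fun f -> \bigcup_n A n = setT ->
  (forall n, L0_indic P (mA n) *: y = L0_indic P (mA n) *: x n) ->
  (forall n, (f (x n) <= L0_ext r)%O) -> (f y <= L0_ext r)%O.
Proof.
move=> cf AT yx fx; apply/barL0_leP.
have h n : \forall w \ae P, A n w -> (f y w <= L0_ext r w)%E.
  have xi01 : 0 <= L0_indic P (mA n) <= 1.
    apply/andP; split; apply/L0_leP.
      apply: filterS2 (L0_indicE P (mA n)) (L0_0E P) => w -> ->.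
      by rewrite indicE ler0n.
    apply: filterS2 (L0_indicE P (mA n)) (L0_1E P) => w -> ->.
    by rewrite indicE lern1 leq_b1.
  (* As [y] and [x n] agree on [A n], the combination of [x n] and [y] is [y] itself. *)
  have := cf _ (x n) y xi01; rewrite -yx -scalerDl subrKC scale1r => fy.
  have /barL0_leP fr := fx n; near=> w => Anw.
  apply: (le_trans (near fy w _)) => //.
  rewrite (near (L0_addE _ _) w)// (near (L0_oppE _) w)//.
  rewrite (near (L0_1E P) w)// (near (L0_indicE P (mA n)) w)//.
  rewrite indicE mem_set// subrr mul1e mul0e dadde0.
  exact: (near fr w).
apply: filterS (ae_foralln h) => w fw.
have [n _ Anw] : (\bigcup_n A n) w by rewrite AT.
exact: fw n Anw.
Unshelve. all: by end_near. Qed.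

End module_facts.

(** * Symmetric sublevel sets around a point, and continuity there *)

Section symmetric_sublevel.
Context d (T : measurableType d) (R : realType) (P : probability T R).
Variables (E : rlcModType P) (f : E -> barL0 P).
Hypothesis fconvex : L0_convex_fun f.
Implicit Types (x y : E) (a b c r xi eta : L0 P).

(** The reflected condition makes the set symmetric, which convexity turns into balancedness; it
    also supplies the bound at [x0 - y] behind the lower estimate. *)
Definition sym_sublevel (x0 : E) (r : L0 P) : set E :=
  [set x | (f (x0 + x) <= L0_ext r)%O /\ (f (x0 - x) <= L0_ext r)%O].

Lemma sym_sublevel_closed x0 r : Tc_lower_semicontinuous f ->
  closed (sym_sublevel x0 r : set (Tc E)).
Proof.
move=> flsc.
have cl eta : L0_abs eta <= 1 ->
    closed ([set x | (f (x0 + eta *: x) <= L0_ext r)%O] : set (Tc E)).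
  move=> eta1; apply: (preimage_closed _ (flsc r)) => x _.
  exact: continuous_affine.
have -> : sym_sublevel x0 r =
    [set x | (f (x0 + 1 *: x) <= L0_ext r)%O] `&`
    [set x | (f (x0 + (- 1) *: x) <= L0_ext r)%O].
  by apply/seteqP; split=> x; rewrite /sym_sublevel/= scaleN1r scale1r.
by apply: closedI; apply: cl; rewrite ?L0_abs_opp L0_abs_1.
Qed.

Lemma sym_sublevel_convex x0 r : L0_convex_set (sym_sublevel x0 r).
Proof.
move=> xi x y xi01 [x1 x2] [y1 y2].
(* Both [r] and [x0] are written as convex combinations of themselves, so that convexity passes
   through the translation by [x0]. *)
have -> : r = xi * r + (1 - xi) * r by rewrite -mulrDl subrKC mul1r.
have e z : x0 = z -> x0 = xi *: z + (1 - xi) *: z.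
  by move=> ->; rewrite -scalerDl subrKC scale1r.
split.
  rewrite [X in X + _](e x0)// addrACA -!scalerDr.
  exact: L0_convex_epigraph.
rewrite [X in X - _](e x0)// opprD addrACA -!scalerN -!scalerDr.
exact: L0_convex_epigraph.
Qed.

(* [eta = xi - (1 - xi)] with [xi = (1 + eta) / 2]. *)
Lemma sym_sublevel_balanced x0 r : L0_balanced (sym_sublevel x0 r).
Proof.
move=> eta x /L0_leP eta1 Bx; pose xi : L0 P := L0_cst P 2^-1 * (1 + eta).
have xiE : \forall w \ae P, xi w = (1 + eta w) / 2.
  near=> w; rewrite (near (L0_mulE _ _) w)// (near (L0_addE _ _) w)//.
  by rewrite (near (L0_1E P) w)// (near (L0_cstE P _) w)// mulrC.
have {}eta1 : \forall w \ae P, - 1 <= eta w <= 1.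
  near=> w; rewrite -ler_norml -(near (L0_absE eta) w)//.
  by rewrite -(near (L0_1E P) w)//; apply: (near eta1 w).
have -> : eta = xi - (1 - xi).
  apply/L0P; near=> w; rewrite !(near (L0_addE _ _) w)//.
  rewrite !(near (L0_oppE _) w)// (near (L0_addE _ _) w)//.
  rewrite !(near (L0_oppE _) w)// (near (L0_1E P) w)// (near xiE w)//.
  by field.
(* Thus [eta *: x] is a convex combination of [x] and [- x], both in the set. *)
rewrite scalerBl -scalerN; apply: sym_sublevel_convex => //.
  apply/andP; split; apply/L0_leP.
    by apply: filterS3 xiE eta1 (L0_0E P) => w -> h ->; lra.
  by apply: filterS3 xiE eta1 (L0_1E P) => w -> h ->; lra.
by case: Bx => ? ?; split; rewrite ?opprK.
Unshelve. all: by end_near. Qed.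

Lemma sym_sublevel_concatenation x0 r :
  countable_concatenation [set: E] ->
  countable_concatenation (sym_sublevel x0 r).
Proof.
move=> cc x A mA Bx tA AT; have [y _ yx] := cc x A mA (fun=> I) tA AT.
exists y => //; split.
  apply: (@L0_convex_local _ _ _ _ _ f (fun n => x0 + x n) _ A mA) => //.
    by move=> n; rewrite !scalerDr yx.
  by move=> n; case: (Bx n).
apply: (@L0_convex_local _ _ _ _ _ f (fun n => x0 - x n) _ A mA) => //.
  by move=> n; rewrite !scalerBr yx.
by move=> n; case: (Bx n).
Qed.

(** This form isolates the increment [xi * (b - a)] over the base value, which a small weight [xi]
    makes small. *)
Lemma L0_convex_chord x y a b xi : 0 <= xi <= 1 ->
  (f x <= L0_ext a)%O -> (f (x + y) <= L0_ext b)%O ->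
  (f (x + xi *: y) <= L0_ext (a + xi * (b - a)))%O.
Proof.
move=> xi01 fx fy.
have -> : x + xi *: y = xi *: (x + y) + (1 - xi) *: x.
  by rewrite scalerDr scalerBl scale1r addrAC addrC subrKC addrC.
have -> : a + xi * (b - a) = xi * b + (1 - xi) * a by ring.
exact: L0_convex_epigraph.
Qed.

Hypothesis fproper : L0_proper f.

(** Properness excludes [-oo] and the domain excludes [+oo], so [fine] loses no information. *)
Lemma L0_domP x : L0_dom f x -> exists a, f x = L0_ext a.
Proof.
move=> fx; have mf := measurableT_comp (@fine_measurable R setT measurableT)
  (barL0_measurable (f x)).
exists (L0_class P mf); apply/barL0P; near=> w.
rewrite (near (L0_extE _) w)// (near (L0_classE P mf) w)//= fineK//.
rewrite fin_numElt; apply/andP; split; first exact: (near (fproper.2 x) w).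
exact: (near fx w).
Unshelve. all: by end_near. Qed.

Lemma sym_sublevel_absorbent x0 a : nbhs (x0 : Tc E) (L0_dom f) ->
  (f x0 <= L0_ext a)%O -> L0_absorbent (sym_sublevel x0 (a + 1)).
Proof.
move=> [Q [eps [fQ sQ e0 domf]]] fa x.
have [dl dl0 hdl] := finite_seminorms_absorb x fQ sQ e0.
have dldl : L0_abs dl <= dl.
  apply/L0_leP; apply: filterS2 (L0_absE dl) dl0 => w ->.
  by move=> /ltW /ger0_norm ->.
have domP eta : L0_abs eta <= dl -> L0_dom f (x0 + eta *: x).
  by move=> /hdl h; apply/domf/(Tc_ballP _ _ fQ).
have dlN : L0_abs (- dl) <= dl by rewrite L0_abs_opp.
have [b fb] := L0_domP (domP _ dldl).
have [c fc] := L0_domP (domP (- dl) dlN).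
(* A single weight [l] brings the increments along both chords, towards [x0 + dl *: x] and
   [x0 - dl *: x], down to at most 1. *)
have [l l0 hl] := L0pp_small (L0_abs (b - a) + L0_abs (c - a)).
have {}hl : \forall w \ae P, [/\ l w <= 1, l w * (b w - a w) <= 1 &
    l w * (c w - a w) <= 1].
  near=> w; case: (near hl w) => // l1.
  rewrite (near (L0_addE _ _) w)// !(near (L0_absE _) w)//.
  rewrite !(near (L0_addE _ _) w)// !(near (L0_oppE _) w)// ger0_norm//.
  have lw : 0 < l w by apply: (near l0 w).
  by move=> h; split=> //; apply: le_trans h; rewrite ler_pM2l//;
    have := ler_norm (b w - a w); have := ler_norm (c w - a w);
      have := normr_ge0 (b w - a w); have := normr_ge0 (c w - a w); lra.
have l01 : 0 <= l <= 1.
  apply/andP; split; apply/L0_leP.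
    by apply: filterS2 l0 (L0_0E P) => w /ltW ? ->.
  by apply: filterS2 hl (L0_1E P) => w [? _ _] ->.
have bnd y e : f (x0 + y) = L0_ext e ->
    (\forall w \ae P, l w * (e w - a w) <= 1) ->
    (f (x0 + l *: y) <= L0_ext (a + 1))%O.
  move=> fe he; have fle : (f (x0 + y) <= L0_ext e)%O by rewrite fe.
  apply: le_trans (L0_convex_chord l01 fa fle) _; apply/L0_ext_le/L0_leP.
  near=> w; rewrite (near (L0_addE _ _) w)// (near (L0_mulE _ _) w)//.
  rewrite !(near (L0_addE _ _) w)// (near (L0_oppE _) w)//.
  by rewrite (near (L0_1E P) w)// lerD2l; apply: (near he w).
have Blx : sym_sublevel x0 (a + 1) (l *: (dl *: x)).
  split; first by apply: bnd fb _; apply: filterS hl => w [].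
  rewrite -scalerN -scaleNr.
  by apply: bnd fc _; apply: filterS hl => w [].
have [k k0 klx] := L0pp_inv (L0ppM l0 dl0).
exists (l * dl); first exact: L0ppM.
move=> eta /L0_leP etal.
(* Since [k] inverts [l * dl], the factor [eta * k] has modulus at most 1 and balancedness
   applies. *)
have -> : eta *: x = (eta * k) *: (l *: (dl *: x)).
  by rewrite !scalerA -!mulrA klx mulr1.
apply: sym_sublevel_balanced => //; apply/L0_leP.
near=> w; rewrite (near (L0_1E P) w)// (near (L0_absE _) w)//.
rewrite (near (L0_mulE eta _) w)// normrM.
have kw : 0 < k w by apply: (near k0 w).
have : k w * (l * dl : L0 P) w = 1.
  by rewrite -(near (L0_mulE k _) w)// klx (near (L0_1E P) w).
move=> <-; rewrite (gtr0_norm kw) mulrC ler_pM2l//.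
by rewrite -(near (L0_absE _) w)//; apply: (near etal w).
Unshelve. all: by end_near. Qed.

Lemma sym_sublevel_barrel x0 a : Tc_lower_semicontinuous f ->
  nbhs (x0 : Tc E) (L0_dom f) -> (f x0 <= L0_ext a)%O ->
  L0_barrel (sym_sublevel x0 (a + 1)).
Proof.
move=> flsc x0dom fa; split.
- exact: sym_sublevel_closed.
- exact: sym_sublevel_balanced.
- exact: sym_sublevel_convex.
- exact: sym_sublevel_absorbent.
Qed.

(* [y = l (l^-1 y)] bounds [f (x0 + y)] above along a chord; the lower bound
   then follows since [x0] is the midpoint of [x0 + y] and [x0 - y]. *)
Lemma sym_sublevel_nbhs_continuous (x0 : E) (g : Tc E -> Tc (L0 P)^o) :
  nbhs (x0 : Tc E) (L0_dom f) -> (forall x, L0_dom f x -> f x = L0_ext (g x)) ->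
  nbhs (0 : Tc E) (sym_sublevel x0 ((g x0 : L0 P) + 1)) ->
  {for (x0 : Tc E), continuous g}.
Proof.
move=> x0dom fg [Q [eps [fQ sQ e0 hB]]] V [Q' [eps' [fQ' sQ' e0' hV]]].
have dom0 := nbhs_singleton x0dom.
(* The bound 1 makes [l] a convex weight; the bound [eps'] makes it an admissible oscillation of
   [g]. *)
pose a : L0 P := g x0; pose l := L0_min 1 eps'.
have l0 : L0pp l by apply: L0pp_min => //; exact: L0pp1.
have [l1 leps] : l <= 1 /\ l <= eps' by exact: L0_min_le.
have l01 : 0 <= l <= 1.
  rewrite l1 andbT; apply/L0_leP.
  by apply: filterS2 l0 (L0_0E P) => w /ltW ? ->.
have [k k0 kl] := L0pp_inv l0.
exists Q, (l * eps); split=> //; first exact: L0ppM.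
move=> y /(Tc_ballP _ _ fQ) Qy.
have By : sym_sublevel x0 (a + 1) (k *: y).
  rewrite -[k *: y]add0r; apply/hB/(Tc_ballP _ _ fQ) => p Qp.
  have [p0 pZ _] := L0_seminormsP p (sQ _ Qp).
  have /L0_leP py := Qy p Qp.
  rewrite pZ; apply/L0_leP; near=> w.
  have kw : 0 < k w by apply: (near k0 w).
  have klw : k w * l w = 1.
    by rewrite -(near (L0_mulE k l) w)// kl (near (L0_1E P) w).
  rewrite (near (L0_mulE _ _) w)// (near (L0_absE _) w)// gtr0_norm//.
  rewrite -[leRHS]mul1r -klw -mulrA ler_pM2l//.
  by rewrite -(near (L0_mulE l eps) w)//; apply: (near py w).
have lky : l *: (k *: y) = y by rewrite scalerA mulrC kl scale1r.
have fa : (f x0 <= L0_ext a)%O by rewrite fg.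
have chord z : (f (x0 + z) <= L0_ext (a + 1))%O ->
    (f (x0 + l *: z) <= L0_ext (a + l))%O.
  move=> /(L0_convex_chord l01 fa).
  by rewrite [a + 1]addrC addrK mulr1.
have up : (f (x0 + y) <= L0_ext (a + l))%O by rewrite -lky; apply/chord/By.1.
have dn : (f (x0 - y) <= L0_ext (a + l))%O.
  by rewrite -lky -scalerN; apply/chord/By.2.
have domy : L0_dom f (x0 + y).
  move/barL0_leP: up => up; near=> w.
  apply: (@le_lt_trans _ _ (L0_ext (a + l) w)); first exact: (near up w).
  by rewrite (near (L0_extE _) w)// ltry.
pose b : L0 P := g (x0 + y).
have fb : f (x0 + y) = L0_ext b by exact: fg.
pose h := L0_cst P 2^-1.
have hE : \forall w \ae P, h w = 2^-1 by exact: L0_cstE.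
have hh : h + h = 1.
  apply/L0P; near=> w; rewrite (near (L0_addE h h) w)//.
  by rewrite (near (L0_1E P) w)// (near hE w)//; field.
have h01 : 0 <= h <= 1.
  apply/andP; split; apply/L0_leP.
    by apply: filterS2 hE (L0_0E P) => w -> ->; lra.
  by apply: filterS2 hE (L0_1E P) => w -> ->; lra.
have fbb : (f (x0 + y) <= L0_ext b)%O by rewrite fb.
(* The midpoint inequality reads [a <= (b + (a + l)) / 2], that is, [a - l <= b]. *)
have := L0_convex_epigraph fconvex h01 fbb dn.
rewrite -[X in X - h]hh addrK -scalerDr addrACA subrr addr0 scalerDr.
rewrite -scalerDl hh scale1r -mulrDr.
rewrite (fg x0)// => /L0_ext_le /L0_leP low.
move: up; rewrite fb => /L0_ext_le /L0_leP up.
have gb : g x0 + (b - a : (L0 P)^o) = g (x0 + y) by exact: (subrKC a b).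
(* The absolute value is the only seminorm of [(L0 P)^o], so it suffices to bound [b - a] in modulus
   by [l], hence by [eps']. *)
rewrite /preimage/= -gb; apply/hV/(Tc_ballP _ _ fQ') => p /sQ' ->.
move/L0_leP: leps => leps.
apply/L0_leP; near=> w; rewrite (near (L0_absE _) w)//.
apply: (@le_trans _ _ (l w)); last exact: (near leps w).
rewrite (near (L0_addE b (- a)) w)// (near (L0_oppE a) w)//.
have : b w <= a w + l w.
  by rewrite -(near (L0_addE a l) w)//; apply: (near up w).
have : a w <= (b w + (a w + l w)) / 2.
  rewrite mulrC -(near hE w)// -(near (L0_addE a l) w)//.
  rewrite -(near (L0_addE b (a + l)) w)// -(near (L0_mulE h _) w)//.
  exact: (near low w).
rewrite ler_norml; lra.
Unshelve. all: by end_near. Qed.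

End symmetric_sublevel.

(** The function [g] is [f] with its finite values read in [L0 P], which gives continuity its target
    space. *)
Theorem corollary4p11 (d : measure_display) (T : measurableType d)
    (R : realType) (P : probability T R) (E : rlcModType P)
    (hE : L0_pre_barreled E)
    (hcc : countable_concatenation [set: E])
    (f : E -> barL0 P)
    (hproper : L0_proper f)
    (hlsc : Tc_lower_semicontinuous f)
    (hconvex : L0_convex_fun f) :
  exists2 g : Tc E -> Tc (L0 P)^o,
    (forall x, interior (L0_dom f) x -> f x = L0_ext (g x)) &
    {within interior (L0_dom f), continuous g}.
Proof.
have [g fg] : exists g : Tc E -> Tc (L0 P)^o,
    forall x, L0_dom f x -> f x = L0_ext (g x).
  have /choice[g fg] : forall x : Tc E, exists a : Tc (L0 P)^o,
      L0_dom f x -> f x = L0_ext a.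
    move=> x; have [/(L0_domP hproper)[a fa]|ndom] := pselect (L0_dom f x).
      by exists a.
    (* Outside the domain, 0 is a default value. *)
    by exists 0.
  by exists g.
exists g => [x /interior_subset|]; first exact: fg.
(* The interior is open, so relative continuity reduces to continuity at each of its points. *)
rewrite continuous_open_subspace; last exact: open_interior.
move=> x0 /set_mem x0dom; have dom0 := interior_subset x0dom.
apply: (sym_sublevel_nbhs_continuous hconvex x0dom fg).
apply: hE; last exact: sym_sublevel_concatenation.
by apply: sym_sublevel_barrel => //; rewrite fg.
Qed.
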